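(* Assume that $A=[a_{ij}]\in\mathrm{M}_n$ is an upper triangular matrix such that (a) $a_{ii}=a_{kk}$ for all $1\le i,k\le n$, and (b) $a_{i,i+1}\neq 0$ for all $1\le i\le n-1$. Then the following statements are equivalent for an upper triangular matrix $A'\in\mathrm{M}_n$: (1) $\|f(A_i)\|=\|f(A'_i)\|$ for all polynomials $f\in\mathbb{C}[t]$ and all $1\le i\le n$; (2) $A'=W^*AW$ for some diagonal unitary matrix $W\in\mathrm{M}_n$. Here, for $X\in\mathrm{M}_n$ and $1\le k\le n$, $X_k\in\mathrm{M}_k$ denotes the leading $k\times k$ principal submatrix of $X$.
   Context: $\mathrm{M}_n$ denotes the algebra of all $n\times n$ complex matrices. If $X=[x_{ij}]_{i,j=1}^n\in\mathrm{M}_n$ and $1\le k\le n$, then $X_k=[x_{ij}]_{i,j=1}^k\in\mathrm{M}_k$. The norm on each $\mathrm{M}_k$ is $\|X\|=\sqrt{\mathrm{spr}(X^*X)}$, where $\mathrm{spr}$ is the spectral radius; that is, the operator (spectral) norm, equivalently the largest singular value. $\mathbb{C}[t]$ is the ring of polynomials in one variable with complex coefficients. *)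

(* Defs.v *)
From mathcomp Require Import all_boot all_order all_algebra.
From mathcomp Require Import classical_sets reals.
From mathcomp.real_closed Require Import complex.
Set Implicit Arguments.
Unset Strict Implicit.
Unset Printing Implicit Defensive.
Import Order.TTheory GRing.Theory Num.Theory.
Local Open Scope ring_scope.
Local Open Scope classical_set_scope.
Local Open Scope sesquilinear_scope.

(* [is_trig_mx] is lower triangularity. *)
Definition is_upper_trig_mx (R : pzSemiRingType) (n : nat) (A : 'M[R]_n) : bool :=
  is_trig_mx A^T.

Definition leading_mx (T : Type) (n k : nat) (hk : (k <= n)%N) (A : 'M[T]_n) :
    'M[T]_k :=
  mxsub (widen_ord hk) (widen_ord hk) A.

(* On R[i] the norm [`|z|] is R[i]-valued (with zero imaginary part), hence the
   real part.  The set is finite, and nonempty as soon as 0 < n, so that [sup]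
   is then a maximum. *)
Definition spectral_radius (R : realType) (n : nat) (A : 'M[R[i]]_n) : R :=
  sup [set complex.Re `|z| | z in [set z | eigenvalue A z]].

Definition spectral_norm (R : realType) (n : nat) (A : 'M[R[i]]_n) : R :=
  Num.sqrt (spectral_radius (A ^t* *m A)).

(* Main.v *)
Require Import Defs.
From mathcomp Require Import all_boot all_order all_algebra.
From mathcomp Require Import boolp classical_sets reals.
From mathcomp.real_closed Require Import complex.
Set Implicit Arguments.
Unset Strict Implicit.
Unset Printing Implicit Defensive.
Import Order.TTheory GRing.Theory Num.Theory.
Local Open Scope ring_scope.
Local Open Scope sesquilinear_scope.

(** Unitary similarity preserves the norms, and conjugation by a diagonal
unitary commutes with taking leading submatrices, so only (1) => (2) needs an
argument.

Subtracting the common diagonal entry from both matrices amounts to a change of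
variable in the polynomials; after that [A] is strictly upper triangular, hence
nilpotent.  So some power of the shifted [A'] has norm zero, and it is strictly
upper triangular too ([diag_eq0_of_spectral_norms]).  The phases are found column by
column ([strictly_upper_phase]): once the columns before the last one of a
leading block have been made equal, the last columns have to be compared.

Let [X] and [Y] be strictly upper triangular of size [n + 1], equal outside the
last column, and let [D = Y - X].  The last row of [Y] is zero, so [D * Y = 0]
and [Y ^ (k + 1) = X ^ k * Y] ([exp_lastcol]).  The matrices [X ^ n] and
[Y ^ n] live in the upper right corner, and comparing their norms shows that
the superdiagonal entries of the last columns differ by a phase
([last_column_phase]); rotate it away.  Now suppose [D] is not zero and let [i]
be its last nonzero row, which lies above the superdiagonal entry.  Then
[Y ^ (i + 1) = X ^ (i + 1) + E] with [E = X ^ i * D] a nonzero corner matrix,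
while [X ^ n = Y ^ n] is also a nonzero corner matrix, so that [E = c X ^ n].
The polynomials [t ^ (i + 1) + m c t ^ n] therefore send [X] to
[X ^ (i + 1) + m E] and [Y] to [X ^ (i + 1) + (m + 1) E], so the norm of
[X ^ (i + 1) + m E] does not depend on the natural number [m].  But it grows
without bound ([spectral_norm_unbounded]), a contradiction
([last_column_rigid]). *)

(** * The spectral norm *)

Lemma eigenvalue_similar (F : fieldType) (n : nat) (V H : 'M[F]_n) (z : F) :
  V \in unitmx -> eigenvalue (invmx V *m H *m V) z = eigenvalue H z.
Proof.
move=> Vu; apply/eigenvalueP/eigenvalueP => -[v vH v0].
  exists (v *m invmx V).
    by rewrite scalemxAl -vH !mulmxA mulmxK.
  by rewrite mulmx_free_eq0 // row_free_unit unitmx_inv.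
exists (v *m V); last by rewrite mulmx_free_eq0 // row_free_unit.
by rewrite !mulmxA mulmxK // vH -scalemxAl.
Qed.

Lemma eigenvalue_diag_mx (F : fieldType) (n : nat) (d : 'rV[F]_n) (z : F) :
  eigenvalue (diag_mx d) z <-> exists k, z = d 0 k.
Proof.
rewrite eigenvalue_root_char char_poly_trig ?diag_mx_is_trig //.
rewrite -(big_map (fun i => diag_mx d i i) predT (fun x => 'X - x%:P)).
rewrite root_prod_XsubC; split.
  by case/mapP => k _ ->; exists k; rewrite mxE eqxx.
case=> k ->; apply/mapP; exists k; first by rewrite mem_index_enum.
by rewrite mxE eqxx.
Qed.

Section SpectralNorm.
Variable R : realType.
Implicit Types n : nat.

Lemma Re_normK (z : R[i]) : (complex.Re `|z|)%:C%C = `|z|.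
Proof. by rewrite RRe_real ?normr_real. Qed.

Lemma Re_norm_ge0 (z : R[i]) : 0 <= complex.Re `|z|.
Proof. by rewrite -ler0c Re_normK. Qed.

Lemma spectral_radius_similar n (V H : 'M[R[i]]_n) :
  V \in unitmx -> spectral_radius (invmx V *m H *m V) = spectral_radius H.
Proof.
move=> Vu; rewrite /spectral_radius.
suff -> : eigenvalue (invmx V *m H *m V) = eigenvalue H by [].
by apply/funext => z; rewrite eigenvalue_similar.
Qed.

Lemma spectral_norm_unitary n (W M : 'M[R[i]]_n) :
  W \is unitarymx -> spectral_norm (W^t* *m M *m W) = spectral_norm M.
Proof.
move=> Wu; have Wunit := unitarymx_unit Wu.
have adjE : (W^t* *m M *m W)^t* = W^t* *m M^t* *m W.
  by rewrite !trmx_mul !map_mxM trmxCK !mulmxA.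
have gramE : (W^t* *m M *m W)^t* *m (W^t* *m M *m W) =
    invmx W *m (M^t* *m M) *m W.
  by rewrite adjE invmx_unitary // !mulmxA mulmxtVK.
by rewrite /spectral_norm gramE (spectral_radius_similar _ Wunit).
Qed.

Lemma le_spectral_radius n (P : 'M[R[i]]_n) (d : 'rV[R[i]]_n) k :
  P \in unitmx ->
  `|d 0 k| <= (spectral_radius (invmx P *m diag_mx d *m P))%:C%C.
Proof.
move=> Pu; rewrite spectral_radius_similar //.
rewrite -[leLHS]Re_normK lecR.
apply: ub_le_sup; last first.
  by exists (d 0 k) => //=; apply/eigenvalue_diag_mx; exists k.
exists (\sum_l complex.Re `|d 0 l|) => _ /= [z /eigenvalue_diag_mx [l ->] <-].
rewrite (bigD1 l) //= lerDl sumr_ge0 // => j _.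
exact: Re_norm_ge0.
Qed.

Lemma spectral_radius_diag_le n (d : 'rV[R[i]]_n.+1) (b : R) :
  (forall k, `|d 0 k| <= b%:C%C) -> spectral_radius (diag_mx d) <= b.
Proof.
move=> db; apply: ge_sup.
  exists (complex.Re `|d 0 0|), (d 0 0) => //=.
  by apply/eigenvalue_diag_mx; exists 0.
move=> _ /= [z /eigenvalue_diag_mx [l ->] <-].
by rewrite -lecR Re_normK.
Qed.

Lemma gram_entry n (M : 'M[R[i]]_n) j :
  (M^t* *m M) j j = \sum_i `|M i j| ^+ 2.
Proof. by rewrite mxE; apply: eq_bigr => i _; rewrite !mxE normCK mulrC. Qed.

(** Diagonalize the Gram matrix by a unitary: its [j]-th diagonal entry, which is
the squared length of the [j]-th column of [M], is a convex combination of its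
eigenvalues. *)
Lemma entry_le_spectral_norm n (M : 'M[R[i]]_n) i j :
  `|M i j| <= (spectral_norm M)%:C%C.
Proof.
have Hn : M^t* *m M \is normalmx.
  by apply/normalmxP; rewrite trmx_mul map_mxM trmxCK.
have /orthomx_spectralP HE := Hn; set P := spectralmx _ in HE.
set d := spectral_diag _ in HE.
have Pu : P \is unitarymx by apply: spectral_unitarymx.
set s := spectral_radius (M^t* *m M).
have ds k : `|d 0 k| <= s%:C%C.
  by rewrite /s HE; apply: le_spectral_radius; apply: unitarymx_unit.
have Pcol : \sum_k `|P k j| ^+ 2 = 1.
  rewrite -gram_entry -invmx_unitary // mulVmx ?unitarymx_unit //.
  by rewrite mxE eqxx.
have key : `|M i j| ^+ 2 <= s%:C%C.
  apply: (@le_trans _ _ ((M^t* *m M) j j)).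
    rewrite gram_entry (bigD1 i) //= lerDl sumr_ge0 // => k _.
    by rewrite exprn_ge0.
  have G0 : 0 <= (M^t* *m M) j j.
    by rewrite gram_entry sumr_ge0 // => k _; rewrite exprn_ge0.
  rewrite -(ger0_norm G0) HE invmx_unitary // mul_mx_diag mxE.
  apply: (le_trans (ler_norm_sum _ _ _)).
  rewrite -[leRHS]mul1r -Pcol mulr_suml ler_sum // => k _.
  rewrite !mxE !normrM norm_conjC mulrAC -expr2 ler_wpM2l //.
  by rewrite exprn_ge0.
have s0 : 0 <= s by rewrite -ler0c (le_trans _ key) // exprn_ge0.
rewrite -(@ler_pXn2r _ 2) ?nnegrE ?normr_ge0 ?ler0c ?sqrtr_ge0 //.
have -> : (spectral_norm M)%:C%C ^+ 2 = s%:C%C :> R[i].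
  by rewrite -rmorphXn /spectral_norm /= sqr_sqrtr.
by [].
Qed.

Lemma spectral_norm_eq0 n (M : 'M[R[i]]_n) : spectral_norm M = 0 -> M = 0.
Proof.
move=> M0; apply/matrixP => i j; rewrite mxE; apply/eqP.
by rewrite -normr_le0 -(rmorph0 (real_complex R)) -M0 entry_le_spectral_norm.
Qed.

(** The Gram matrix is diagonal here, with the single nonzero entry [|c| ^ 2]. *)
Lemma spectral_norm_delta n (c : R[i]) (i j : 'I_n.+1) :
  (spectral_norm (c *: delta_mx i j))%:C%C = `|c|.
Proof.
apply/le_anti/andP; split; last first.
  have := entry_le_spectral_norm (c *: delta_mx i j) i j.
  by rewrite !mxE !eqxx mulr1.
rewrite -[leRHS]Re_normK lecR.
rewrite -[leRHS]ger0_norm ?Re_norm_ge0 // -sqrtr_sqr; apply: ler_wsqrtr.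
have -> : (c *: delta_mx i j)^t* *m (c *: delta_mx i j) =
    diag_mx (\row_k (`|c| ^+ 2 *+ (k == j))).
  apply/matrixP => k l; rewrite !mxE (bigD1 i) //= big1 ?addr0; last first.
    by move=> m mi; rewrite !mxE (negPf mi) mulr0 conjC0 mul0r.
  rewrite !mxE !eqxx /= rmorphM rmorph_nat normCK mulrC.
  have [->|kj] := eqVneq k j; last by rewrite !mulr0 mul0rn.
  by case: eqVneq => _; rewrite ?mulr0 ?mul0r ?mulr1 mulrC.
apply: spectral_radius_diag_le => k; rewrite mxE.
rewrite rmorphXn /= Re_normK.
case: eqP => _; rewrite ?mulr1n ?mulr0n ?normr0 ?exprn_ge0 //.
by rewrite ger0_norm // exprn_ge0.
Qed.
(** The spectral norm dominates every entry, and a nonzero entry of [Y] makes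
the same entry of [X + m Y] grow without bound. *)
Lemma spectral_norm_unbounded n (X Y : 'M[R[i]]_n) (s : R) :
  (forall m, spectral_norm (X + Y *+ m) <= s) -> Y = 0.
Proof.
move=> XYs; apply/matrixP => i j; rewrite [RHS]mxE; apply/eqP/negPn/negP => Yij.
pose t := complex.Re ((s%:C%C + `|X i j|) / `|Y i j|).
have bnd m : `|Y i j| *+ m <= s%:C%C + `|X i j|.
  rewrite -normrMn -lerBlDr; apply: (@le_trans _ _ (`|(X + Y *+ m) i j|)).
    have -> : (X + Y *+ m) i j = Y i j *+ m + X i j by rewrite mxE mulmxnE addrC.
    exact: lerB_normD.
  by rewrite (le_trans (entry_le_spectral_norm _ _ _)) // lecR.
have tE : t%:C%C = (s%:C%C + `|X i j|) / `|Y i j|.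
  rewrite /t RRe_real // realM ?realV ?normr_real // realD ?normr_real //.
  by rewrite complex_real.
have bt m : (m%:R : R) <= t.
  by rewrite -lecR tE rmorph_nat ler_pdivlMr ?normr_gt0 // mulr_natl.
have := bt (Num.bound `|t|); rewrite leNgt => /negP; apply.
by rewrite (le_lt_trans (ler_norm t)) // archi_boundP ?normr_ge0.
Qed.
End SpectralNorm.

(** * Matrices vanishing below a superdiagonal *)

(** The filtration of the upper triangular matrices by superdiagonals: [p = 0]
gives the upper triangular matrices, [p = 1] the strictly upper triangular
ones, and [p >= n] only the zero matrix. *)
Definition supband (F : pzRingType) (n p : nat) (X : 'M[F]_n) :=
  forall i j : 'I_n, (j < i + p)%N -> X i j = 0.

Section Band.
Variable F : nzRingType.

Lemma supband_mul n p q (X Y : 'M[F]_n) :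
  supband p X -> supband q Y -> supband (p + q) (X *m Y).
Proof.
move=> bX bY i j jipq; rewrite mxE big1 // => k _.
have [ki|ik] := ltnP k (i + p); first by rewrite bX ?mul0r.
rewrite bY ?mulr0 //; apply: (leq_trans jipq).
by rewrite addnA leq_add2r.
Qed.

(** On the lowest superdiagonal where a product can be nonzero, only one term of
the sum survives. *)
Lemma supband_mul_edge n p q (X Y : 'M[F]_n) (i k j : 'I_n) :
  supband p X -> supband q Y -> (k = i + p :> nat)%N -> (j = k + q :> nat)%N ->
  (X *m Y) i j = X i k * Y k j.
Proof.
move=> bX bY ki jk; rewrite mxE (bigD1 k) //= big1 ?addr0 // => l lk.
have [li|il] := ltnP l (i + p); first by rewrite bX ?mul0r.
rewrite bY ?mulr0 // jk ltn_add2r ltn_neqAle ki il andbT.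
by rewrite -ki eq_sym.
Qed.

Lemma supband_exp n (X : 'M[F]_n.+1) k : supband 1 X -> supband k (X ^+ k).
Proof.
move=> bX; elim: k => [|k IH].
  by move=> i j; rewrite addn0 expr0 mxE -val_eqE => /gtn_eqF->.
by rewrite exprSr -(addn1 k); apply: supband_mul.
Qed.

Lemma supband_corner n (X : 'M[F]_n.+1) :
  supband n X -> X = X 0 ord_max *: delta_mx 0 ord_max.
Proof.
move=> bX; apply/matrixP => i j; rewrite !mxE.
have [->|i0] := eqVneq i 0; last first.
  rewrite mulr0 bX //; apply: (leq_trans (ltn_ord j)).
  by rewrite -[X in (X <= _)%N]add1n leq_add2r lt0n.
have [->|jn] := eqVneq j ord_max; first by rewrite mulr1.
by rewrite mulr0 bX //= add0n ltn_neqAle -ltnS ltn_ord andbT.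
Qed.

Lemma supband_eq0 n (X : 'M[F]_n) : supband n X -> X = 0.
Proof.
move=> bX; apply/matrixP => i j; rewrite mxE bX //.
by rewrite (leq_trans (ltn_ord j)) ?leq_addl.
Qed.

Lemma supband_exp_diag n (X : 'M[F]_n.+1) i k :
  supband 0 X -> (X ^+ k) i i = X i i ^+ k.
Proof.
move=> bX; suff [_ ->] : supband 0 (X ^+ k) /\ (X ^+ k) i i = X i i ^+ k by [].
elim: k => [|k [IHb IH]].
  split; last by rewrite expr0 mxE eqxx.
  by move=> l j; rewrite addn0 expr0 mxE -val_eqE => /gtn_eqF->.
rewrite !exprSr; split; first exact: (@supband_mul _ 0 0).
by rewrite (@supband_mul_edge _ 0 0 _ _ _ i) ?addn0 // IH.
Qed.

(** The last row of a strictly upper triangular [Y] is zero, so a left factor of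
[Y] may be changed in its last column: [X * Y = Y * Y]. *)
Lemma exp_lastcol n (X Y : 'M[F]_n.+1) k :
  supband 1 Y -> (forall i j : 'I_n.+1, (j < n)%N -> X i j = Y i j) ->
  Y ^+ k.+1 = X ^+ k * Y.
Proof.
move=> bY colXY; have XYY : X * Y = Y * Y.
  apply/matrixP => i j; rewrite !mxE; apply: eq_bigr => l _.
  have [ln|nl] := ltnP l n; first by rewrite colXY.
  by rewrite (bY l) ?mulr0 // addn1 ltnS (leq_trans _ nl) // -ltnS.
elim: k => [|k IH]; first by rewrite expr1 expr0 mul1r.
by rewrite exprSr IH exprSr -!mulrA XYY.
Qed.

End Band.

(** The entry is a product of superdiagonal entries. *)
Lemma supband_exp_edge_neq0 (F : idomainType) n (X : 'M[F]_n.+1) k (i j : 'I_n.+1) :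
  supband 1 X -> (forall i j : 'I_n.+1, j = i.+1 :> nat -> X i j != 0) ->
  (j = i + k :> nat)%N -> (X ^+ k) i j != 0.
Proof.
move=> bX sX; elim: k j => [|k IH] j jik.
  have -> : j = i by apply: val_inj; rewrite /= jik addn0.
  by rewrite expr0 mxE eqxx oner_neq0.
have lt : (i + k < n.+1)%N.
  by rewrite (leq_ltn_trans _ (ltn_ord j)) // jik leq_add2l.
rewrite exprSr (@supband_mul_edge _ _ k 1 _ _ _ (Ordinal lt)) //; first last.
- by rewrite jik addn1 addnS.
- exact: supband_exp.
by rewrite mulf_neq0 ?IH ?sX //= jik addnS.
Qed.

(** * Invariance under phases *)
Section Phases.
Variable R : realType.

Lemma spectral_norm_horner_unitary n (W M : 'M[R[i]]_n.+1) f :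
  W \is unitarymx ->
  spectral_norm (horner_mx (W^t* *m M *m W) f) = spectral_norm (horner_mx M f).
Proof.
move=> Wu; rewrite -(spectral_norm_unitary (horner_mx M f) Wu).
suff -> : horner_mx (W^t* *m M *m W) f = W^t* *m horner_mx M f *m W by [].
rewrite -invmx_unitary //; apply: horner_mx_uconjC.
exact: unitarymx_unit.
Qed.

Lemma phase_unitary n (w : 'I_n -> R[i]) :
  (forall i, `|w i| = 1) -> diag_mx (\row_i w i) \is unitarymx.
Proof.
move=> w1; apply/unitarymxP; rewrite tr_diag_mx map_diag_mx mulmx_diag.
apply/matrixP => i j; rewrite !mxE.
by case: eqP => // _; rewrite -normCK w1 expr1n.
Qed.

Lemma phase_conjE n (w : 'I_n -> R[i]) (X : 'M[R[i]]_n) i j :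
  let W := diag_mx (\row_i w i) in
  (W^t* *m X *m W) i j = (w i)^* * X i j * w j.
Proof.
by rewrite /= tr_diag_mx map_diag_mx mul_mx_diag mxE mul_diag_mx !mxE.
Qed.

Lemma spectral_norm_horner_phase n (w : 'I_n.+1 -> R[i]) (X Y : 'M[R[i]]_n.+1) f :
  (forall i, `|w i| = 1) -> (forall i j, Y i j = (w i)^* * X i j * w j) ->
  spectral_norm (horner_mx Y f) = spectral_norm (horner_mx X f).
Proof.
move=> w1 YE; rewrite -(spectral_norm_horner_unitary X f (phase_unitary w1)).
set Z := (_ *m _); suff -> : Y = Z by [].
by apply/matrixP => i j; rewrite phase_conjE.
Qed.

End Phases.

(** * Recovering the columns *)
Section Columns.
Variable R : realType.

(** The heart of the matter: moving the last column of [X] above its lowest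
nonzero entry shifts the corner entry of some power of [X] by a constant while
leaving [X ^ n] alone, and adding multiples of [t ^ n] to the polynomial repeats
the shift arbitrarily often. *)
Lemma last_column_rigid n (X Y : 'M[R[i]]_n.+1) :
  supband 1 X -> supband 1 Y ->
  (forall i j : 'I_n.+1, j = i.+1 :> nat -> X i j != 0) ->
  (forall i j : 'I_n.+1, (j < n)%N -> X i j = Y i j) ->
  (forall i j : 'I_n.+1, j = i.+1 :> nat -> X i j = Y i j) ->
  (forall f, spectral_norm (horner_mx X f) = spectral_norm (horner_mx Y f)) ->
  X = Y.
Proof.
move=> bX bY sX colXY sXY normXY; pose D : 'M_n.+1 := Y - X.
have YE : Y = X + D by rewrite addrC subrK.
have D0 (i j : 'I_n.+1) : (j < n)%N -> D i j = 0.
  by move=> jn; rewrite !mxE colXY ?subrr.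
suff bD p : supband p.+2 D.
  apply/eqP; rewrite eq_sym -subr_eq0; apply/eqP/supband_eq0.
  move=> i j jin; apply: (bD n.-1 i j).
  by rewrite (leq_trans jin) // leq_add2l; case: (n).
elim: p => [|p bD] i j.
  rewrite addn2 ltnS leq_eqVlt => /orP[/eqP/sXY e|ji]; first by rewrite !mxE e subrr.
  by rewrite !mxE bX ?bY ?subrr // addn1.
(* Only one entry of [D] on this superdiagonal can be nonzero: the one at the
   last column, in row [i = n - (p + 2)]. *)
rewrite addnS ltnS leq_eqVlt => /orP[/eqP jE|]; last exact: bD.
have [jn|nj] := ltnP j n; first exact: D0.
have jn : j = n :> nat by apply/eqP; rewrite eqn_leq nj -ltnS ltn_ord.
pose E := X ^+ i *m D.
have bE : supband n E.
  have : supband (i + p.+2) E by apply: supband_mul => //; apply: supband_exp.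
  by rewrite -jE jn.
have E0 : E 0 j = (X ^+ i) 0 i * D i j.
  by apply: (@supband_mul_edge _ _ i p.+2) => //; apply: supband_exp.
have Xi : (X ^+ i) 0 i != 0 by apply: supband_exp_edge_neq0.
suff EE : E = 0.
  by move/eqP: E0; rewrite EE mxE eq_sym mulf_eq0 (negPf Xi) => /eqP.
have YXi : Y ^+ i.+1 = X ^+ i.+1 + E.
  by rewrite (exp_lastcol _ bY colXY) {1}YE mulrDr -exprSr.
have n0 : (0 < n)%N by rewrite -jn jE addnS.
(* [X ^ (n - 1) * D] vanishes since [D] starts at the second superdiagonal. *)
have pow k : k.+1 = n -> Y ^+ k.+1 = X ^+ k.+1.
  move=> kn; rewrite (exp_lastcol _ bY colXY) {1}YE mulrDr -exprSr.
  rewrite [X in _ + X]supband_eq0 ?addr0 //.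
  have bXD : supband (k + p.+2) (X ^+ k *m D).
    by apply: supband_mul => //; apply: supband_exp.
  move=> l m lm; apply: bXD; apply: (leq_trans lm); rewrite leq_add2l.
  by rewrite -addSnnS kn addnS ltnS leq_addr.
have YXn : Y ^+ n = X ^+ n by have := pow n.-1; rewrite prednK //; apply.
have Xn0 : (X ^+ n) 0 ord_max != 0 by apply: supband_exp_edge_neq0.
pose c := E 0 ord_max / (X ^+ n) 0 ord_max.
have EX : E = c *: X ^+ n.
  rewrite (supband_corner bE) [X ^+ n]supband_corner; last exact: supband_exp.
  by rewrite scalerA /c divfK.
pose f m : {poly R[i]} := 'X^(i.+1) + (c *+ m) *: 'X^n.
have fE Z m : horner_mx Z (f m) = Z ^+ i.+1 + (c *: Z ^+ n) *+ m.
  by rewrite rmorphD /= linearZ /= !rmorphXn /= !horner_mx_X scalerMnl.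
have step m :
    spectral_norm (X ^+ i.+1 + E *+ m.+1) = spectral_norm (X ^+ i.+1 + E *+ m).
  have := normXY (f m); rewrite !fE YXn YXi -EX => ->.
  by rewrite mulrS addrA.
apply: (@spectral_norm_unbounded _ _ (X ^+ i.+1) _ (spectral_norm (X ^+ i.+1))).
elim=> [|m IH]; last by rewrite step.
by rewrite mulr0n addr0 lexx.
Qed.

(** The corner entries of [X ^ n] and [Y ^ n] share the factor coming from the
common columns, so their norms compare the entries of the last columns on the
superdiagonal. *)
Lemma last_column_phase n (X Y : 'M[R[i]]_n.+1) :
  supband 1 X -> supband 1 Y ->
  (forall i j : 'I_n.+1, j = i.+1 :> nat -> X i j != 0) ->
  (forall i j : 'I_n.+1, (j < n)%N -> X i j = Y i j) ->
  (forall f, spectral_norm (horner_mx X f) = spectral_norm (horner_mx Y f)) ->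
  exists w, `|w| = 1 /\ forall i, Y i ord_max = X i ord_max * w.
Proof.
move=> bX bY sX colXY normXY.
(* A strictly upper triangular matrix of size one is zero. *)
have [n0|n0] := posnP n.
  exists 1; split=> [|i]; first exact: normr1.
  by rewrite bX ?bY ?mul0r //= {1}n0 addn1.
have qP : (n.-1 < n.+1)%N by rewrite ltnS leq_pred.
pose q := Ordinal qP; have nq : n = q.+1 by rewrite /= prednK.
have expn (V : 'M[R[i]]_n.+1) : V ^+ n = V ^+ q.+1 by congr (_ ^+ _).
have YXn : Y ^+ n = X ^+ q *m Y by rewrite expn; apply: exp_lastcol.
have corner Z : supband 1 Z -> Z ^+ n = X ^+ q *m Z ->
    Z ^+ n = ((X ^+ q) 0 q * Z q ord_max) *: delta_mx 0 ord_max.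
  move=> bZ ZE; rewrite [LHS]supband_corner; last exact: supband_exp.
  rewrite {1}ZE (@supband_mul_edge _ _ q 1 _ _ _ q) //; last by rewrite addn1.
  exact: supband_exp.
have Xq : (X ^+ q) 0 q != 0 by apply: supband_exp_edge_neq0.
have Xqn : X q ord_max != 0 by apply: sX.
have normq : `|X q ord_max| = `|Y q ord_max|.
  have XXn : X ^+ n = X ^+ q *m X by rewrite expn exprSr.
  have := normXY 'X^n; rewrite !rmorphXn /= !horner_mx_X.
  rewrite (corner X bX XXn) (corner Y bY YXn).
  set a := _ * X q _; set b := _ * Y q _ => e.
  have : `|a| = `|b|.
    have := spectral_norm_delta a (0 : 'I_n.+1) ord_max.
    by rewrite e spectral_norm_delta.
  by rewrite !normrM; apply: mulfI; rewrite normr_eq0.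
pose w := Y q ord_max / X q ord_max.
have w1 : `|w| = 1 by rewrite /w normf_div -normq divff // normr_eq0.
have w0 : w != 0 by rewrite -normr_eq0 w1 oner_neq0.
exists w; split=> // i.
(* Conjugating by [v] divides the last column of [Y] by [w], and does nothing
   else because the last row of [Y] is zero. *)
pose v (j : 'I_n.+1) : R[i] := if j == ord_max then w^-1 else 1.
have v1 j : `|v j| = 1.
  by rewrite /v; case: eqP => _; rewrite ?normrV ?unitfE ?w1 ?invr1 ?normr1.
pose Z : 'M_n.+1 := \matrix_(i, j) ((v i)^* * Y i j * v j).
have vlt (j : 'I_n.+1) : (j < n)%N -> v j = 1.
  by move=> jn; rewrite /v -val_eqE /= ltn_eqF.
have bZ : supband 1 Z by move=> k j kj; rewrite mxE bY // mulr0 mul0r.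
have ZE (k j : 'I_n.+1) : Z k j = Y k j * v j.
  rewrite mxE; have [kn|nk] := ltnP k n; first by rewrite vlt // conjC1 mul1r.
  by rewrite bY ?mulr0 // addn1 ltnS (leq_trans _ nk) // -ltnS.
suff XZ : X = Z by rewrite XZ ZE /v eqxx divfK.
apply: (last_column_rigid bX bZ sX) => [k j jn|k j jk|f].
- by rewrite ZE vlt // mulr1 colXY.
- rewrite ZE; have [jn|nj] := ltnP j n; first by rewrite vlt // mulr1 colXY.
  have -> : j = ord_max by apply/val_inj/eqP; rewrite eqn_leq nj -ltnS ltn_ord.
  have -> : k = q.
    apply: val_inj; apply: succn_inj; rewrite -jk -nq; apply/eqP.
    by rewrite eqn_leq nj -ltnS ltn_ord.
  by rewrite /v eqxx /w invf_div mulrCA divff ?mulr1 // -normr_eq0 -normq normr_eq0.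
rewrite normXY; symmetry; apply: (spectral_norm_horner_phase f v1) => k j.
by rewrite mxE.
Qed.

(** Induction on the number [m] of columns already matched.  Undoing the phases
found so far makes the leading blocks of size [m + 1] agree except in their last
column; the phase of that column multiplies the phase attached to index [m],
which the earlier columns do not involve. *)
Lemma strictly_upper_phase n (X Y : 'M[R[i]]_n) :
  supband 1 X -> supband 1 Y ->
  (forall i j : 'I_n, j = i.+1 :> nat -> X i j != 0) ->
  (forall f (k : 'I_n), spectral_norm (horner_mx (leading_mx (ltn_ord k) X) f) =
     spectral_norm (horner_mx (leading_mx (ltn_ord k) Y) f)) ->
  exists w : 'I_n -> R[i], (forall i, `|w i| = 1) /\
    forall i j, Y i j = (w i)^* * X i j * w j.
Proof.
move=> bX bY sX normXY.
suff /(_ n (leqnn n)) [w [w1 wE]] : forall m, (m <= n)%N ->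
    exists w : 'I_n -> R[i], (forall i, `|w i| = 1) /\
      forall i j : 'I_n, (j < m)%N -> Y i j = (w i)^* * X i j * w j.
  by exists w; split=> // i j; apply: wE.
elim=> [|m IH] mn; first by exists (fun=> 1); split=> [i|//]; exact: normr1.
have [w [w1 wE]] := IH (ltnW mn).
have ww i : w i * (w i)^* = 1 by rewrite -normCK w1 expr1n.
pose W := widen_ord mn.
pose X' : 'M_m.+1 := leading_mx mn X.
pose Y' : 'M_m.+1 := leading_mx mn Y.
have X'E i j : X' i j = X (W i) (W j) by rewrite mxE.
pose v i := (w (W i))^*.
have v1 i : `|v i| = 1 by rewrite /v norm_conjC.
pose Z : 'M_m.+1 := \matrix_(i, j) ((v i)^* * Y' i j * v j).
have ZE i j : Z i j = w (W i) * Y (W i) (W j) * (w (W j))^*.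
  by rewrite !mxE /v conjCK.
have [u [u1 uE]] : exists u, `|u| = 1 /\ forall i, Z i ord_max = X' i ord_max * u.
  apply: last_column_phase.
  - by move=> i j ij; rewrite mxE bX.
  - by move=> i j ij; rewrite ZE bY // mulr0 mul0r.
  - by move=> i j ij; rewrite mxE sX.
  - move=> i j jm; rewrite ZE wE // mxE mulrA -[RHS]mulrA ww mulr1.
    by rewrite mulrA ww mul1r.
  move=> f; have := normXY f (Ordinal mn).
  rewrite (bool_irrelevance (ltn_ord (Ordinal mn)) mn) => ->; symmetry.
  by apply: (spectral_norm_horner_phase f v1) => i j; rewrite mxE.
exists (fun i : 'I_n => if i == m :> nat then w i * u else w i); split=> [i|i j].
  by case: eqP => _; rewrite ?normrM ?w1 ?u1 ?mulr1.
rewrite ltnS => jm; have [im|mi] := ltnP i m; last first.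
  by rewrite bX ?bY ?mulr0 ?mul0r // addn1 ltnS (leq_trans jm).
rewrite (ltn_eqF im); have [jEm|jm'] := eqVneq (j : nat) m; last first.
  by apply: wE; rewrite ltn_neqAle jm'.
have iW : i = W (widen_ord (leqnSn m) (Ordinal im)) by apply: val_inj.
have jW : j = W ord_max by apply: val_inj.
have := uE (widen_ord (leqnSn m) (Ordinal im)); rewrite ZE X'E -iW -jW.
move/(congr1 (fun z => (w i)^* * z * w j)).
rewrite !mulrA [_^* * w i]mulrC ww mul1r -mulrA [_^* * w j]mulrC ww mulr1 => ->.
by rewrite -!mulrA [u * _]mulrC.
Qed.
End Columns.

(** * The theorem *)

Lemma horner_mx_shift (F : comNzRingType) n (B : 'M[F]_n.+1) (a : F) f :
  horner_mx (B - a%:M) f = horner_mx B (f \Po ('X - a%:P)).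
Proof.
elim/poly_ind: f => [|f c IH]; first by rewrite comp_poly0 !rmorph0.
rewrite comp_polyD comp_polyM comp_polyX comp_polyC !rmorphD !rmorphM /= IH.
by rewrite !horner_mx_C rmorphB /= !horner_mx_X horner_mx_C.
Qed.

Lemma leading_mx_shift (F : pzRingType) n k (hk : (k <= n)%N) (A : 'M[F]_n) a :
  leading_mx hk (A - a%:M) = leading_mx hk A - a%:M.
Proof. by apply/matrixP => i j; rewrite !mxE. Qed.

(** [X ^ (n + 1) = 0] forces [Y ^ (n + 1) = 0], and the diagonal of a power of an
upper triangular matrix consists of the powers of its diagonal entries. *)
Lemma diag_eq0_of_spectral_norms (R : realType) n (X Y : 'M[R[i]]_n.+1) :
  supband 1 X -> supband 0 Y ->
  (forall f, spectral_norm (horner_mx X f) = spectral_norm (horner_mx Y f)) ->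
  forall i, Y i i = 0.
Proof.
move=> bX bY normXY i.
have X0 : X ^+ n.+1 = 0 by apply: supband_eq0; apply: supband_exp.
have := normXY 'X^(n.+1); rewrite !rmorphXn /= !horner_mx_X X0.
have -> : spectral_norm (0 : 'M[R[i]]_n.+1) = 0.
  apply: (@complexI R); have := @spectral_norm_delta R n 0 0 0.
  by rewrite scale0r normr0 => ->.
move/esym/spectral_norm_eq0 => Y0.
have := supband_exp_diag i n.+1 bY; rewrite Y0 mxE => /esym/eqP.
by rewrite expf_eq0 => /andP[_ /eqP].
Qed.

Theorem theorem3p2 (R : realType) (n : nat) (n_gt0 : (0 < n)%N)
    (A : 'M[R[i]]_n)
    (A_upper : is_upper_trig_mx A)
    (A_diag : forall i k : 'I_n, A i i = A k k)
    (A_superdiag : forall i j : 'I_n, j = i.+1 :> nat -> A i j != 0)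
    (A' : 'M[R[i]]_n)
    (A'_upper : is_upper_trig_mx A') :
  (forall (f : {poly R[i]}) (k : 'I_n),
     spectral_norm (horner_mx (leading_mx (ltn_ord k) A) f) =
     spectral_norm (horner_mx (leading_mx (ltn_ord k) A') f))
  <->
  (exists W : 'M[R[i]]_n,
     [/\ is_diag_mx W, W \is unitarymx & A' = W ^t* *m A *m W]).
Proof.
split=> [normAA' | [W [/diag_mxP [d ->] Wu A'E]] f k]; last first.
  have [d_row WE] : exists w : 'I_n -> R[i], diag_mx d = diag_mx (\row_i w i).
    by exists (d 0); congr diag_mx; apply/rowP => i; rewrite mxE.
  have w1 i : `|d_row i| = 1.
    have := unitarymxP Wu; rewrite WE tr_diag_mx map_diag_mx mulmx_diag.
    move/matrixP/(_ i i); rewrite !mxE eqxx -normCK => /eqP.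
    by rewrite sqrp_eq1 ?normr_ge0 // => /eqP.
  pose v i := d_row (widen_ord (ltn_ord k) i).
  symmetry; apply: (@spectral_norm_horner_phase _ _ v); first by move=> i; apply: w1.
  by move=> i j; rewrite mxE A'E WE phase_conjE !mxE.
have [n' nE] : exists n', n = n'.+1 by exists n.-1; rewrite prednK.
subst n; pose a := A ord0 ord0.
pose N : 'M_n'.+1 := A - a%:M; pose N' : 'M_n'.+1 := A' - a%:M.
have NE : A = N + a%:M by rewrite subrK.
have upper0 (B : 'M[R[i]]_n'.+1) (i j : 'I_n'.+1) :
    is_upper_trig_mx B -> (j < i)%N -> B i j = 0.
  by move=> /is_trig_mxP Bu /Bu; rewrite mxE.
have normN f (k : 'I_n'.+1) :
    spectral_norm (horner_mx (leading_mx (ltn_ord k) N) f) =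
    spectral_norm (horner_mx (leading_mx (ltn_ord k) N') f).
  by rewrite !leading_mx_shift !horner_mx_shift normAA'.
have bN : supband 1 N.
  move=> i j; rewrite addn1 ltnS leq_eqVlt => /orP[/eqP/val_inj->|ji].
    by rewrite !mxE eqxx (A_diag i ord0) subrr.
  by rewrite !mxE upper0 // -val_eqE (gtn_eqF ji) subrr.
have b0N' : supband 0 N'.
  move=> i j; rewrite addn0 => ji.
  by rewrite !mxE upper0 // -val_eqE (gtn_eqF ji) subrr.
have leadT (B : 'M[R[i]]_n'.+1) : leading_mx (ltn_ord ord_max) B = B.
  by apply/matrixP => i j; rewrite mxE; congr (B _ _); apply: val_inj.
have dN' : forall i, N' i i = 0.
  apply: (diag_eq0_of_spectral_norms bN b0N') => f.
  by have := normN f ord_max; rewrite !leadT.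
have bN' : supband 1 N'.
  move=> i j; rewrite addn1 ltnS leq_eqVlt => /orP[/eqP/val_inj->|ji].
    exact: dN'.
  by apply: b0N'; rewrite addn0.
have sN (i j : 'I_n'.+1) : j = i.+1 :> nat -> N i j != 0.
  move=> ji; rewrite !mxE -val_eqE /= ji ltn_eqF // mulr0n subr0.
  exact: A_superdiag.
have [w [w1 wE]] := strictly_upper_phase bN bN' sN normN.
exists (diag_mx (\row_i w i)); split.
- exact: diag_mx_is_diag.
- exact: phase_unitary.
have -> : A' = N' + a%:M by rewrite subrK.
rewrite NE mulmxDr mulmxDl; congr (_ + _).
  by apply/matrixP => i j; rewrite phase_conjE wE.
have Wu := phase_unitary w1.
by rewrite scalar_mxC -mulmxA (mulmx1C (unitarymxP Wu)) mulmx1.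
Qed.
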